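(* For every $n\ge1$, $\mathrm{LTOCC}_n\subseteq\mathrm{LTOCC}_n+\mathrm M$.
   Context: Alice and Bob hold systems in energy-incoherent states (probability vectors), with Gibbs vectors $\gamma^{(A)},\gamma^{(B)}$ with strictly positive entries. A local thermal operation is a (column-)stochastic matrix $\Lambda$ with $\Lambda\gamma=\gamma$ for the corresponding Gibbs vector. Indices $k,l$ denote Alice's and Bob's inputs, $i,j$ their outputs. Thermal tensors: $T^{(B)}_{jkl}\ge0$, $\sum_jT^{(B)}_{jkl}=1$, $\sum_lT^{(B)}_{jkl}\gamma^{(B)}_l=\gamma^{(B)}_j$ for all $j,k$; $T^{(A)}_{ikl}\ge0$, $\sum_iT^{(A)}_{ikl}=1$, $\sum_kT^{(A)}_{ikl}\gamma^{(A)}_k=\gamma^{(A)}_i$ for all $i,l$. $\mathrm{LTOCC}_n$: products $M=\prod_{\alpha=1}^nM^{(\alpha)}$ of stochastic matrices each of the form $M^{(\alpha)}_{ij,kl}=\Lambda^{(A,\alpha)}_{ik}T^{(B,\alpha)}_{jkl}$ or $M^{(\alpha)}_{ij,kl}=T^{(A,\alpha)}_{ikl}\Lambda^{(B,\alpha)}_{jl}$, with $\Lambda$'s local thermal operations and $T$'s thermal tensors. $\mathrm{LTOCC}_n+\mathrm M$: stochastic matrices obtained as follows. Start from $r^{(0)}_{kl}$. In round $\alpha=1,\dots,n$ one party measures. If Alice measures, $$r^{(\alpha)}_{ij,m_1\dots m_\alpha}=\sum_{k,l}\mathcal A^{(\alpha;m_1\dots m_{\alpha-1})}_{ik}\,\delta_{k,m_\alpha}\,\mathcal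 B^{(\alpha;m_1\dots m_\alpha)}_{jl}\,r^{(\alpha-1)}_{kl,m_1\dots m_{\alpha-1}},$$ where for each value of the memory indices $\mathcal A^{(\alpha;\cdot)}$, $\mathcal B^{(\alpha;\cdot)}$ are local thermal operations of Alice and Bob; if Bob measures, the same with $\delta_{l,m_\alpha}$, Alice's operation conditioned on $m_1,\dots,m_\alpha$ and Bob's on $m_1,\dots,m_{\alpha-1}$. At the end $m_1,\dots,m_n$ are summed over. *)

(* Defs.v *)
From mathcomp Require Import all_boot all_order all_algebra.

Set Implicit Arguments.
Unset Strict Implicit.
Unset Printing Implicit Defensive.

Import Order.TTheory GRing.Theory Num.Theory.
Local Open Scope ring_scope.

(* Matrices act on column vectors, so stochastic means column-stochastic. *)
Definition stochastic (R : realFieldType) (m n : nat) (M : 'M[R]_(m, n)) : Prop :=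
  (forall i j, 0 <= M i j) /\ (forall j, \sum_i M i j = 1).

Definition gibbs_vector (R : realFieldType) (d : nat) (g : 'cV[R]_d) : Prop :=
  (forall i, 0 < g i 0) /\ \sum_i g i 0 = 1.

Definition local_thermal (R : realFieldType) (d : nat) (g : 'cV[R]_d)
    (L : 'M[R]_d) : Prop :=
  stochastic L /\ L *m g = g.

(* [T j k l]: Bob's output j, Alice's input k, Bob's input l. *)
Definition thermal_tensorB (R : realFieldType) (dA dB : nat) (gB : 'cV[R]_dB)
    (T : 'I_dB -> 'I_dA -> 'I_dB -> R) : Prop :=
  [/\ forall j k l, 0 <= T j k l,
      forall k l, \sum_j T j k l = 1 &
      forall j k, \sum_l T j k l * gB l 0 = gB j 0].

(* [T i k l]: Alice's output i, Alice's input k, Bob's input l. *)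
Definition thermal_tensorA (R : realFieldType) (dA dB : nat) (gA : 'cV[R]_dA)
    (T : 'I_dA -> 'I_dA -> 'I_dB -> R) : Prop :=
  [/\ forall i k l, 0 <= T i k l,
      forall k l, \sum_i T i k l = 1 &
      forall i l, \sum_k T i k l * gA k 0 = gA i 0].

(* The entry M_{ij,kl} of a matrix on the composite system, whose basis is
   indexed by pairs through [mxvec_index]. *)
Definition entry (R : realFieldType) (dA dB : nat) (M : 'M[R]_(dA * dB))
    (i : 'I_dA) (j : 'I_dB) (k : 'I_dA) (l : 'I_dB) : R :=
  M (mxvec_index i j) (mxvec_index k l).

Definition LTOCC_round (R : realFieldType) (dA dB : nat)
    (gA : 'cV[R]_dA) (gB : 'cV[R]_dB) (M : 'M[R]_(dA * dB)) : Prop :=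
  stochastic M /\
  ((exists (L : 'M[R]_dA) (T : 'I_dB -> 'I_dA -> 'I_dB -> R),
      [/\ local_thermal gA L, thermal_tensorB gB T &
          forall i j k l, entry M i j k l = L i k * T j k l]) \/
   (exists (T : 'I_dA -> 'I_dA -> 'I_dB -> R) (L : 'M[R]_dB),
      [/\ thermal_tensorA gA T, local_thermal gB L &
          forall i j k l, entry M i j k l = T i k l * L j l])).

Definition LTOCC (R : realFieldType) (dA dB : nat)
    (gA : 'cV[R]_dA) (gB : 'cV[R]_dB) (n : nat) (M : 'M[R]_(dA * dB)) : Prop :=
  exists Ms : 'I_n -> 'M[R]_(dA * dB),
    (forall a, LTOCC_round gA gB (Ms a)) /\ M = \prod_(a < n) Ms a.

(* [memory_run gA gB n X F]: some n-round protocol with memory stores its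
   outcomes (m_1, ..., m_n) in X and turns every initial r^(0) into
   r^(n)_{ij,m} = F r^(0) i j m.  The memory type X is the nested product
   unit * O_1 * ... * O_n, where O_a indexes the levels of the party that
   measures in round a; so in a round started with memory [m : X], the non
   measuring party's operation depends on [m] and on the new outcome, while the
   measuring party's operation depends on [m] only.  The protocol is chosen
   before, hence independently of, r^(0). *)
Inductive memory_run (R : realFieldType) (dA dB : nat)
    (gA : 'cV[R]_dA) (gB : 'cV[R]_dB) :
    forall (n : nat) (X : finType),
      ('M[R]_(dA, dB) -> 'I_dA -> 'I_dB -> X -> R) -> Prop :=
| run_start :
    @memory_run R dA dB gA gB 0 unit (fun r i j _ => r i j)
| run_alice (n : nat) (X : finType)
    (F : 'M[R]_(dA, dB) -> 'I_dA -> 'I_dB -> X -> R)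
    (A : X -> 'M[R]_dA) (B : X -> 'I_dA -> 'M[R]_dB) :
    @memory_run R dA dB gA gB n X F ->
    (forall m, local_thermal gA (A m)) ->
    (forall m o, local_thermal gB (B m o)) ->
    @memory_run R dA dB gA gB n.+1 (X * 'I_dA)%type
      (fun r i j mo => let: (m, o) := mo in
         \sum_k \sum_l A m i k * (k == o)%:R * B m o j l * F r k l m)
| run_bob (n : nat) (X : finType)
    (F : 'M[R]_(dA, dB) -> 'I_dA -> 'I_dB -> X -> R)
    (A : X -> 'I_dB -> 'M[R]_dA) (B : X -> 'M[R]_dB) :
    @memory_run R dA dB gA gB n X F ->
    (forall m o, local_thermal gA (A m o)) ->
    (forall m, local_thermal gB (B m)) ->
    @memory_run R dA dB gA gB n.+1 (X * 'I_dB)%type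
      (fun r i j mo => let: (m, o) := mo in
         \sum_k \sum_l A m o i k * (l == o)%:R * B m j l * F r k l m).

Definition LTOCC_M (R : realFieldType) (dA dB : nat)
    (gA : 'cV[R]_dA) (gB : 'cV[R]_dB) (n : nat) (M : 'M[R]_(dA * dB)) : Prop :=
  stochastic M /\
  exists (X : finType) (F : 'M[R]_(dA, dB) -> 'I_dA -> 'I_dB -> X -> R),
    memory_run gA gB n F /\
    forall (r : 'M[R]_(dA, dB)) i j,
      \sum_k \sum_l entry M i j k l * r k l = \sum_(m : X) F r i j m.

(* Main.v *)
Require Import Defs.
From mathcomp Require Import all_boot all_order all_algebra.

(* The tensor T^(B)_{jkl} of a round measured by Alice is a family, indexed by
   her level k, of local thermal operations of Bob; measuring k and letting Bob
   apply the k-th operation reproduces the round once the outcome is summed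
   over.  All operations are taken independent of the earlier memory. *)

Set Implicit Arguments.
Unset Strict Implicit.
Unset Printing Implicit Defensive.

Import Order.TTheory GRing.Theory Num.Theory.

Local Open Scope ring_scope.

Lemma stochastic1 (R : realFieldType) (d : nat) :
  stochastic (1%:M : 'M[R]_d).
Proof.
split=> [i j|j]; first by rewrite mxE ler0n.
rewrite (bigD1 j) //= mxE eqxx big1 ?addr0 // => i /negPf ij.
by rewrite mxE ij.
Qed.

Lemma stochastic_mulmx (R : realFieldType) (m n p : nat)
    (M : 'M[R]_(m, n)) (N : 'M[R]_(n, p)) :
  stochastic M -> stochastic N -> stochastic (M *m N).
Proof.
move=> [M0 M1] [N0 N1]; split=> [i j|j].
  by rewrite mxE sumr_ge0 // => k _; rewrite mulr_ge0.
under eq_bigr do rewrite mxE.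
rewrite exchange_big /= -(N1 j); apply: eq_bigr => k _.
by rewrite -mulr_suml M1 mul1r.
Qed.

(** Reindexing along the bijection [mxvec_index] between pairs and composite indices. *)
Lemma sum_mxvec_index (R : realFieldType) (m n : nat) (f : 'I_(m * n) -> R) :
  \sum_p f p = \sum_i \sum_j f (mxvec_index i j).
Proof.
rewrite pair_big /=.
rewrite (reindex (uncurry (@mxvec_index m n))) /=; last first.
  exact: curry_mxvec_bij.
by apply: eq_bigr => -[].
Qed.

(** The argument [f] is a bare function, so that memory-summed families and earlier actions can be
    fed in without repackaging them as matrices. *)
Definition entry_action (R : realFieldType) (dA dB : nat)
    (M : 'M[R]_(dA * dB)) (f : 'I_dA -> 'I_dB -> R) i j : R :=
  \sum_k \sum_l entry M i j k l * f k l.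

Lemma entry_action_col (R : realFieldType) (dA dB : nat) (M : 'M[R]_(dA * dB))
    (v : 'cV[R]_(dA * dB)) i j :
  entry_action M (fun k l => v (mxvec_index k l) 0) i j =
  (M *m v) (mxvec_index i j) 0.
Proof. by rewrite mxE sum_mxvec_index. Qed.

(** Flattening [r] to a column turns the action into a matrix product, from which the identity and
    composition laws follow. *)
Lemma entry_action_mx (R : realFieldType) (dA dB : nat) (M : 'M[R]_(dA * dB))
    (r : 'M[R]_(dA, dB)) i j :
  entry_action M r i j = (M *m (mxvec r)^T) (mxvec_index i j) 0.
Proof.
rewrite -entry_action_col; apply: eq_bigr => k _; apply: eq_bigr => l _.
by rewrite mxE mxvecE.
Qed.

Lemma entry_action1 (R : realFieldType) (dA dB : nat) (r : 'M[R]_(dA, dB)) i j :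
  entry_action 1%:M r i j = r i j.
Proof. by rewrite entry_action_mx mul1mx mxE mxvecE. Qed.

Lemma entry_action_mulmx (R : realFieldType) (dA dB : nat)
    (M N : 'M[R]_(dA * dB)) (r : 'M[R]_(dA, dB)) i j :
  entry_action (M *m N) r i j = entry_action M (entry_action N r) i j.
Proof.
rewrite entry_action_mx -mulmxA -entry_action_col.
by apply: eq_bigr => k _; apply: eq_bigr => l _; rewrite entry_action_mx.
Qed.

(** With [k] fixed, the three tensor conditions become nonnegativity, unit column sums and
    preservation of [gB]. *)
Lemma thermal_tensorB_slice (R : realFieldType) (dA dB : nat)
    (gB : 'cV[R]_dB) (T : 'I_dB -> 'I_dA -> 'I_dB -> R) (k : 'I_dA) :
  thermal_tensorB gB T -> local_thermal gB (\matrix_(j, l) T j k l).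
Proof.
move=> [T0 T1 Tg]; split; first split=> [j l|l].
- by rewrite mxE.
- by rewrite -(T1 k l); apply: eq_bigr => j _; rewrite mxE.
- apply/matrixP => j u; rewrite ord1 mxE -(Tg j k).
  by apply: eq_bigr => l _; rewrite mxE.
Qed.

Lemma thermal_tensorA_slice (R : realFieldType) (dA dB : nat)
    (gA : 'cV[R]_dA) (T : 'I_dA -> 'I_dA -> 'I_dB -> R) (l : 'I_dB) :
  thermal_tensorA gA T -> local_thermal gA (\matrix_(i, k) T i k l).
Proof.
move=> [T0 T1 Tg]; split; first split=> [i k|k].
- by rewrite mxE.
- by rewrite -(T1 k l); apply: eq_bigr => i _; rewrite mxE.
- apply/matrixP => i u; rewrite ord1 mxE -(Tg i l).
  by apply: eq_bigr => k _; rewrite mxE.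
Qed.

Lemma sum_delta (R : realFieldType) (I : finType) (f : I -> R) (k : I) :
  \sum_o (k == o)%:R * f o = f k.
Proof.
rewrite (bigD1 k) //= eqxx mul1r big1 ?addr0 // => o /negPf ko.
by rewrite eq_sym ko mul0r.
Qed.

Lemma sum_pair (R : realFieldType) (I J : finType) (f : I -> J -> R) :
  \sum_p (let: (i, j) := p in f i j) = \sum_i \sum_j f i j.
Proof. by rewrite pair_bigA; apply: eq_bigr => -[]. Qed.

(** The new operations ignore the old memory [x], so the round acts linearly on the sum over [x];
    summing over the new outcome removes the Kronecker delta. *)
Lemma memory_run_round (R : realFieldType) (dA dB : nat)
    (gA : 'cV[R]_dA) (gB : 'cV[R]_dB) (M : 'M[R]_(dA * dB))
    (n : nat) (X : finType) (F : 'M[R]_(dA, dB) -> 'I_dA -> 'I_dB -> X -> R) :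
  LTOCC_round gA gB M -> memory_run gA gB n F ->
  exists (Y : finType) (G : 'M[R]_(dA, dB) -> 'I_dA -> 'I_dB -> Y -> R),
    memory_run gA gB n.+1 G /\
    forall r i j, \sum_y G r i j y =
      entry_action M (fun k l => \sum_x F r k l x) i j.
Proof.
move=> [_ [[L [T [thL thT eM]]]|[T [L [thT thL eM]]]]] run.
- exists (X * 'I_dA)%type; eexists; split.
    apply: (run_alice (A := fun=> L)
      (B := fun _ o => \matrix_(j, l) T j o l) run) => // _ o.
    exact: thermal_tensorB_slice.
  move=> r i j.
  etransitivity; first exact: sum_pair.
  (* The sums over [x], [o], [k], [l] are reordered to [k], [l], [x], [o], leaving the outcome
     innermost. *)
  under eq_bigr do rewrite exchange_big /=.
  rewrite exchange_big; apply: eq_bigr => k _ /=.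
  under eq_bigr do rewrite exchange_big /=.
  rewrite exchange_big; apply: eq_bigr => l _ /=.
  rewrite mulr_sumr; apply: eq_bigr => x _.
  (* Read backwards, [sum_delta] replaces Alice's level [k] in the tensor by an outcome [o] forced
     to equal it. *)
  rewrite eM -mulrA -(sum_delta (fun o => T j o l * F r k l x)) mulr_sumr.
  by apply: eq_bigr => o _; rewrite mxE !mulrA.
- exists (X * 'I_dB)%type; eexists; split.
    apply: (run_bob (A := fun _ o => \matrix_(i, k) T i k o)
      (B := fun=> L) run) => // _ o.
    exact: thermal_tensorA_slice.
  move=> r i j.
  etransitivity; first exact: sum_pair.
  under eq_bigr do rewrite exchange_big /=.
  rewrite exchange_big; apply: eq_bigr => k _ /=.
  under eq_bigr do rewrite exchange_big /=.
  rewrite exchange_big; apply: eq_bigr => l _ /=.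
  rewrite mulr_sumr; apply: eq_bigr => x _.
  (* Here the outcome replaces Bob's level [l] in the tensor only; [L] and [F] keep [l]. *)
  rewrite eM -mulrA -(sum_delta (fun o => T i k o * (L j l * F r k l x))).
  by apply: eq_bigr => o _; rewrite mxE !mulrA [_ * T i k o]mulrC.
Qed.

Lemma LTOCC_memory (R : realFieldType) (dA dB : nat)
    (gA : 'cV[R]_dA) (gB : 'cV[R]_dB) (n : nat) (M : 'M[R]_(dA * dB)) :
  LTOCC gA gB n M -> LTOCC_M gA gB n M.
Proof.
elim: n M => [|n IHn] M [Ms [rnd ->]].
  rewrite big_ord0; split; first exact: stochastic1.
  exists unit, (fun r i j _ => r i j); split; first exact: run_start.
  move=> r i j; rewrite -/(entry_action _ r i j) entry_action1.
  by rewrite (bigD1 tt) //= big1 ?addr0 // => -[].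
(* The leftmost factor acts last on the state, so [Ms ord0] becomes the final round, appended to the
   run for the remaining factors. *)
rewrite big_ord_recl /=.
have [|sN [X [F [run actN]]]] := IHn (\prod_(a < n) Ms (lift ord0 a)).
  by exists (fun a => Ms (lift ord0 a)).
split; first by apply: stochastic_mulmx => //; case: (rnd ord0).
have [Y [G [runG actG]]] := memory_run_round (rnd ord0) run.
exists Y, G; split=> // r i j.
rewrite -/(entry_action _ r i j) entry_action_mulmx actG.
(* Both sides now apply [Ms ord0]; the induction hypothesis identifies its inputs entry by entry. *)
apply: eq_bigr => k _; apply: eq_bigr => l _; congr (_ * _).
exact: actN.
Qed.

Theorem mainTheorem11 (R : realFieldType) (dA dB : nat)
    (gA : 'cV[R]_dA) (gB : 'cV[R]_dB)
    (gibbsA : gibbs_vector gA) (gibbsB : gibbs_vector gB)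
    (n : nat) (n_ge1 : (1 <= n)%N) (M : 'M[R]_(dA * dB)) :
  LTOCC gA gB n M -> LTOCC_M gA gB n M.
Proof. exact: LTOCC_memory. Qed.
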